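(* Let $N\ge 2$ be an integer and let $t\ge 0$ be fixed. Let $(A,d)$ be an infinite compact metric space with $\operatorname{diam}(A)<1$, let $g(s):=\mathcal{E}^s_{\log^t}(A,N)$ for $s\ge 0$, and for each $s\ge 0$ let $\omega_N^{s,\log^t}$ be a minimal $N$-point $s,\log^t$-energy configuration on $A$. Then: (a) $g$ is differentiable at $s=s_0>0$ if and only if $\inf G^{s_0}_{\log^{t+1}}(A,N)=\sup G^{s_0}_{\log^{t+1}}(A,N)$; (b) if $s_0\ge 0$ and $\omega_N^{*}$ is a cluster configuration of $\omega_N^{s,\log^t}$ as $s\to s_0^+$, then $E^{s_0}_{\log^{t+1}}(\omega_N^{*})=\inf G^{s_0}_{\log^{t+1}}(A,N)=g'_+(s_0)$; (c) if $s_0>0$ and $\omega_N^{**}$ is a cluster configuration of $\omega_N^{s,\log^t}$ as $s\to s_0^-$, then $E^{s_0}_{\log^{t+1}}(\omega_N^{**})=\sup G^{s_0}_{\log^{t+1}}(A,N)=g'_-(s_0)$; (d) for $s_0>0$, if there exists a configuration $\omega_N^{*}$ that is a cluster configuration of $\omega_N^{s,\log^t}$ both as $s\to s_0^+$ and as $s\to s_0^-$, then $g$ is differentiable at $s=s_0$ with $E^{s_0}_{\log^{t+1}}(\omega_N^{*})=g'(s_0)$.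
   Context: $\operatorname{diam}(A):=\sup_{x,y\in A}d(x,y)$. An $N$-point configuration is a set $\omega_N\subset A$ of $N$ distinct points. For $s,t\ge 0$ define $$E^s_{\log^t}(\omega_N):=\sum_{\substack{x\ne y\\ x,y\in\omega_N}}\frac{1}{d(x,y)^s}\left(\log\frac{1}{d(x,y)}\right)^t$$ (sum over ordered pairs of distinct points; for $t=0$ the logarithmic factor is $1$), and $$\mathcal{E}^s_{\log^t}(A,N):=\min_{\omega_N\subset A,\ \#\omega_N=N}E^s_{\log^t}(\omega_N).$$ The minimum is attained; a minimizer (not necessarily unique) is called a minimal $N$-point $s,\log^t$-energy configuration. Define the set of real numbers $$G^s_{\log^{t+1}}(A,N):=\{E^s_{\log^{t+1}}(\omega_N):\ \omega_N\subset A,\ \#\omega_N=N,\ E^s_{\log^t}(\omega_N)=\mathcal{E}^s_{\log^t}(A,N)\}.$$ One-sided derivatives: $g'_+(s):=\lim_{r\to s^+}\frac{g(r)-g(s)}{r-s}$ and $g'_-(s):=\lim_{r\to s^-}\frac{g(r)-g(s)}{r-s}$. An $N$-point configuration $\omega_N\subset A$ is a cluster configuration of $\omega_N^{s,\log^t}$ as $s\to s_0^+$ (respectively, as $s\to s_0^-$) if there is a sequence $\{s_k\}_{k=1}^\infty\subset(s_0,\infty)$ (respectively, $\subset[0,s_0)$) with $s_k\to s_0$ and $\omega_N^{s_k,\log^t}\to\omega_N$ as $k\to\infty$ in the topology of $A^N$ induced by $d$ (configurations being regarded as $N$-tuples of points). *)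

(* Defs.v *)
From mathcomp Require Import all_boot all_order all_algebra finmap.
From mathcomp Require Import all_classical all_reals all_analysis.

Set Implicit Arguments.
Unset Strict Implicit.
Unset Printing Implicit Defensive.

Import Order.TTheory GRing.Theory Num.Theory.
Import numFieldTopology.Exports numFieldNormedType.Exports.

Local Open Scope fset_scope.
Local Open Scope classical_set_scope.
Local Open Scope ring_scope.

(* Extended-real valued, so that an unbounded set has diameter +oo and not the
   default value of the real [sup]. *)
Definition diam (R : realType) (A : metricType R) (B : set A) : \bar R :=
  ereal_sup [set (mdist p.1 p.2)%:E | p in B `*` B].

Definition configs (R : realType) (A : metricType R) (N : nat) :
  set {fset A} := [set w : {fset A} | #|` w| = N].
Arguments configs {R} A N.

(* [a `^ 0 = 1] for every [a], so the logarithmic factor is 1 when [t = 0]. *)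
Definition energy (R : realType) (A : metricType R) (s t : R)
    (w : {fset A}) : R :=
  \sum_(x <- w) \sum_(y <- w | x != y)
    1 / (mdist x y `^ s) * ln (1 / mdist x y) `^ t.

(* When the minimum over the [N]-point configurations is attained it is this
   infimum; the energies are bounded below by 0 if [diam A < 1]. *)
Definition min_energy (R : realType) (A : metricType R) (s t : R) (N : nat) :
  R := inf [set energy s t w | w in configs A N].
Arguments min_energy {R} A s t N.

Definition minimal_configs (R : realType) (A : metricType R) (s t : R)
    (N : nat) : set {fset A} :=
  [set w | configs A N w /\ energy s t w = min_energy A s t N].
Arguments minimal_configs {R} A s t N.

(* [G_set A s t N] is the set written G^s_{log^(t+1)}(A, N): the minimality is
   for the exponent [t], the energy is evaluated with the exponent [t + 1]. *)
Definition G_set (R : realType) (A : metricType R) (s t : R) (N : nat) :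
  set R := [set energy s (t + 1) w | w in minimal_configs A s t N].
Arguments G_set {R} A s t N.

(* The limit exists in [R] and equals [l]. *)
Definition is_right_derivative (R : realType) (g : R -> R) (s l : R) : Prop :=
  (g r - g s) / (r - s) @[r --> s^'+] --> l.

Definition is_left_derivative (R : realType) (g : R -> R) (s l : R) : Prop :=
  (g r - g s) / (r - s) @[r --> s^'-] --> l.

(* As [w] has [N] elements, such an [x] lists each of them exactly once. *)
Definition enumerates (R : realType) (A : metricType R) (N : nat)
    (x : 'I_N -> A) (w : {fset A}) : Prop :=
  configs A N w /\ range x = [set` w].

(* Configurations are unordered, so their convergence in [A^N] (with the
   product topology) is that of suitable enumerations. *)
Definition cluster_config (R : realType) (A : metricType R) (N : nat)
    (omega : R -> {fset A}) (D : set R) (s0 : R) (w : {fset A}) : Prop :=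
  configs A N w /\
  exists s_ : nat -> R,
    [/\ forall k, D (s_ k),
        s_ k @[k --> \oo] --> s0
      & exists (x_ : nat -> 'I_N -> A) (x : 'I_N -> A),
        [/\ forall k, enumerates (x_ k) (omega (s_ k)),
            enumerates x w
          & {ptws, x_ @ \oo --> x}]].

Definition right_cluster_config (R : realType) (A : metricType R) (N : nat)
    (omega : R -> {fset A}) (s0 : R) (w : {fset A}) : Prop :=
  cluster_config N omega `]s0, +oo[ s0 w.

Definition left_cluster_config (R : realType) (A : metricType R) (N : nat)
    (omega : R -> {fset A}) (s0 : R) (w : {fset A}) : Prop :=
  cluster_config N omega `[0, s0[ s0 w.

(* Main.v *)
Require Import Defs.
From mathcomp Require Import all_boot all_order all_algebra finmap.
From mathcomp Require Import all_classical all_reals all_analysis.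
From mathcomp Require Import ring lra.

Set Implicit Arguments.
Unset Strict Implicit.
Unset Printing Implicit Defensive.

Import Order.TTheory GRing.Theory Num.Theory.
Import numFieldTopology.Exports numFieldNormedType.Exports.

Local Open Scope fset_scope.
Local Open Scope classical_set_scope.
Local Open Scope ring_scope.

(** Write [L = ln (1 / d)] for the distance [d] of two points; as [d < 1], this
is nonnegative, and positive for distinct points. Each term of the energy is
[exp (s L) L ^ t], a convex function of [s] whose derivative is
[exp (s L) L ^ (t + 1)]. So, for a fixed configuration, the energy of exponent
[t] is convex in [s], and its derivative is the energy of exponent [t + 1].
Here the energy is carried over to [N]-tuples [x], as [tuple_energy s t x], and
[E' s x] stands for [tuple_energy s (t + 1) x].

Let [x] be minimal at [s] and [y] minimal at [r]. Comparing [g r] with the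
energy of [x] at [r], and [g s] with the energy of [y] at [s], and using the
tangent inequality of a convex function, one gets ([min_energy_sandwich])

  [(r - s) E' s y <= g r - g s <= (r - s) E' r x].

Now let [r] tend to [s] from one side, along tuples [y] minimal at [r] that
converge to a tuple [z] of distinct points. By continuity [z] is minimal at [s]
([limit_minimal]). Both ends of the sandwich, divided by [r - s], have limits,
which gives [E' s z <= E' s x] from the right and [E' s z >= E' s x] from the
left for every [x] minimal at [s]: [E' s z] is the least, respectively the
greatest, element of [G_set] ([limit_extremal]). Taking [x = z], both ends have
the same limit, so the difference quotients of [g] tend to [E' s z]
([limit_quotient]). The first fact, applied to the sequence of a cluster
configuration, evaluates its energy. The second one, along every ultrafilter
finer than a one-sided neighborhood filter, gives the one-sided derivatives:
compactness makes the minimal tuples converge along an ultrafilter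
([one_sided_derivative]).

It remains to see that the points of the limit tuple are distinct, that is,
that [L] stays bounded on the tuples minimal at [r]. From the right, the
sandwich bounds [E' s y] (so that [s = 0] is included); from the left, where
[s > 0], the energy itself is bounded near [s] ([right_separated],
[left_separated]). The statements on two-sided derivatives follow by comparing
the one-sided ones. *)

(** * Two facts on real functions *)

Lemma expR_tangent (R : realType) (a b : R) :
  (b - a) * expR a <= expR b - expR a.
Proof.
have -> : b = a + (b - a) by rewrite addrC subrK.
rewrite expRD addrAC subrr add0r -{3}[expR a]mulr1 -mulrBr mulrC.
by apply: ler_wpM2l; rewrite ?expR_ge0// lerBrDl expR_ge1Dx.
Qed.

Lemma cvg_powRl (R : realType) (T : Type) (F : set_system T) {FF : Filter F}
    (f : T -> R) (l t : R) :
  0 < l -> f x @[x --> F] --> l -> f x `^ t @[x --> F] --> l `^ t.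
Proof.
move=> l0 fl.
have lnf : t * ln (f x) @[x --> F] --> t * ln l.
  apply: cvgM; first exact: cvg_cst.
  exact: (continuous_cvg _ (continuous_ln l0) fl).
have H : expR (t * ln (f x)) @[x --> F] --> expR (t * ln l).
  exact: (continuous_cvg _ (@continuous_expR R _) lnf).
rewrite (_ : l `^ t = expR (t * ln l)); last by rewrite /powR gt_eqF.
apply: cvg_trans H; apply: near_eq_cvg.
have H0 : \forall x \near F, 0 < f x by exact: (cvgr_gt _ fl).
apply: filterS H0 => x fx0.
by rewrite /powR gt_eqF.
Qed.

(** * Energy of a pair of points *)

Section logdist.
Context {R : realType} {A : metricType R}.
Implicit Types (x y : A) (s t : R).

Lemma cvg_mdist (T : Type) (F : set_system T) {FF : Filter F}
    (f g : T -> A) x y :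
  f z @[z --> F] --> x -> g z @[z --> F] --> y ->
  mdist (f z) (g z) @[z --> F] --> mdist x y.
Proof.
move=> fx gy; apply/(cvgrPdist_lt) => e e0.
have e2 : 0 < e / 2 by rewrite divr_gt0.
near=> z.
have Hfz : mdist x (f z) < e / 2.
  by near: z; exact: metricType_numDomainType.cvgr_dist_lt fx _ e2.
have Hgz : mdist y (g z) < e / 2.
  by near: z; exact: metricType_numDomainType.cvgr_dist_lt gy _ e2.
rewrite ltr_norml.
have A1 := metric_triangle x (f z) y; have A2 := metric_triangle (f z) (g z) y.
have A3 := metric_triangle (f z) x (g z); have A4 := metric_triangle x y (g z).
rewrite (metric_sym (g z) y) in A2; rewrite (metric_sym (f z) x) in A3.
by apply/andP; split; lra.
Unshelve. all: by end_near. Qed.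

Definition logdist x y : R := - ln (mdist x y).

Definition pair_energy s t x y : R := expR (s * logdist x y) * logdist x y `^ t.

(** Written with [exp], the energy of two distinct points is visibly convex in
[s]. *)
Lemma pair_energyE s t x y : x != y ->
  1 / (mdist x y `^ s) * ln (1 / mdist x y) `^ t = pair_energy s t x y.
Proof.
rewrite -mdist_gt0 => d0.
rewrite /pair_energy /logdist !div1r lnV ?posrE// /powR gt_eqF//.
by rewrite -expRN mulrN.
Qed.

Lemma pair_energy_ge0 s t x y : 0 <= pair_energy s t x y.
Proof. by rewrite mulr_ge0 ?expR_ge0 ?powR_ge0. Qed.

Context (mdist_lt1 : forall x y, mdist x y < 1).

Lemma logdist_ge0 x y : 0 <= logdist x y.
Proof. by rewrite oppr_ge0 ln_le0// ltW. Qed.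

Lemma logdist_gt0 x y : x != y -> 0 < logdist x y.
Proof. by rewrite -mdist_gt0 => d0; rewrite oppr_gt0 ln_lt0// d0 mdist_lt1. Qed.

Lemma pair_energyS s t x y : 0 <= t ->
  pair_energy s (t + 1) x y =
  expR (s * logdist x y) * (logdist x y * logdist x y `^ t).
Proof.
move=> t0; rewrite /pair_energy powRD; last first.
  by apply/implyP => /eqP; lra.
by rewrite (powRr1 (logdist_ge0 _ _)) [X in _ * X]mulrC.
Qed.

(** Convexity in [s]: the graph lies above its tangent at [a], whose slope is
the energy of exponent [t + 1]. Points that coincide cause no exception,
because [ln 0 = 0] makes [logdist] vanish there. *)
Lemma pair_energy_tangent a b t x y : 0 <= t ->
  (b - a) * pair_energy a (t + 1) x y <=
  pair_energy b t x y - pair_energy a t x y.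
Proof.
move=> t0; rewrite pair_energyS// /pair_energy -mulrBl.
set L := logdist x y.
have -> : (b - a) * (expR (a * L) * (L * L `^ t)) =
  ((b * L - a * L) * expR (a * L)) * L `^ t by ring.
by apply: ler_wpM2r; [exact: powR_ge0|exact: expR_tangent].
Qed.

(** A bound on the energy keeps points apart. With exponent [t + 1] this holds
even for [s = 0], as the factor [L ^ (t + 1)] is at least [L] once [1 <= L]. *)
Lemma logdist_le_pair_energyS s t x y C : 0 <= s -> 0 <= t ->
  pair_energy s (t + 1) x y <= C -> logdist x y <= Num.max 1 C.
Proof.
move=> s0 t0 eC; rewrite le_max; have [//|L1 /=] := leP (logdist x y) 1.
apply: le_trans eC; rewrite pair_energyS// mulrCA ler_peMr ?logdist_ge0//.
apply: mulr_ege1.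
  by rewrite -expR0 ler_expR mulr_ge0 ?logdist_ge0.
by rewrite -(powRr0 (logdist x y)) ler_powR// ltW.
Qed.

(** With exponent [t], possibly 0, the exponential factor has to provide the
bound, hence [0 < s]. *)
Lemma logdist_le_pair_energy s t x y C : 0 < s -> 0 <= t ->
  pair_energy s t x y <= C -> logdist x y <= Num.max 1 (C / s).
Proof.
move=> s0 t0 eC; rewrite le_max; have [//|L1 /=] := leP (logdist x y) 1.
rewrite ler_pdivlMr// mulrC; apply: le_trans eC.
have Lt1 : 1 <= logdist x y `^ t.
  by rewrite -(powRr0 (logdist x y)) ler_powR// ltW.
apply: le_trans (ler_peMr (expR_ge0 _) Lt1).
by apply: le_trans (expR_ge1Dx _); rewrite lerDr.
Qed.

Lemma cvg_pair_energy (T : Type) (F : set_system T) {FF : Filter F}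
    (s_ : T -> R) (f g : T -> A) s t x y : x != y ->
  s_ z @[z --> F] --> s -> f z @[z --> F] --> x -> g z @[z --> F] --> y ->
  pair_energy (s_ z) t (f z) (g z) @[z --> F] --> pair_energy s t x y.
Proof.
move=> xy s_s fx gy.
have d0 : 0 < mdist x y by rewrite mdist_gt0.
have Lcvg : logdist (f z) (g z) @[z --> F] --> logdist x y.
  apply: cvgN.
  exact: (continuous_cvg _ (continuous_ln d0) (cvg_mdist fx gy)).
apply: cvgM; last by apply: cvg_powRl => //; exact: logdist_gt0.
by apply: (continuous_cvg _ (@continuous_expR R _)); exact: cvgM.
Qed.

End logdist.

(** * Energy of a tuple of points *)

Section tuple_energy.
Context {R : realType} {A : metricType R} {N : nat}.
Implicit Types (x : 'I_N -> A) (s t : R).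

Definition tuple_energy s t x : R :=
  \sum_i \sum_(j | i != j) pair_energy s t (x i) (x j).

Lemma pair_energy_le_tuple s t x i j : i != j ->
  pair_energy s t (x i) (x j) <= tuple_energy s t x.
Proof.
move=> ij; rewrite /tuple_energy (bigD1 i)//= (bigD1 j)//= -addrA lerDl.
rewrite addr_ge0// sumr_ge0// => k _; first exact: pair_energy_ge0.
by apply: sumr_ge0 => l _; exact: pair_energy_ge0.
Qed.

Lemma tuple_energy_ge0 s t x : 0 <= tuple_energy s t x.
Proof.
by apply: sumr_ge0 => i _; apply: sumr_ge0 => j _; exact: pair_energy_ge0.
Qed.

Context (mdist_lt1 : forall x y : A, mdist x y < 1).

Lemma tuple_energy_tangent a b t x : 0 <= t ->
  (b - a) * tuple_energy a (t + 1) x <=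
  tuple_energy b t x - tuple_energy a t x.
Proof.
move=> t0; rewrite /tuple_energy mulr_sumr -sumrB; apply: ler_sum => i _.
rewrite mulr_sumr -sumrB; apply: ler_sum => j _.
exact: pair_energy_tangent.
Qed.

Lemma le_tuple_energy a b t x : 0 <= t -> a <= b ->
  tuple_energy a t x <= tuple_energy b t x.
Proof.
move=> t0 ab; rewrite -subr_ge0.
apply: le_trans (tuple_energy_tangent _ _ _ t0).
by rewrite mulr_ge0 ?subr_ge0 ?tuple_energy_ge0.
Qed.

(** Joint continuity in [s] and [x], at tuples of distinct points. When two
points merge, the energy may blow up. *)
Lemma cvg_tuple_energy (T : Type) (F : set_system T) {FF : Filter F}
    (s_ : T -> R) (x_ : T -> 'I_N -> A) s t x : injective x ->
  s_ k @[k --> F] --> s -> (forall i, x_ k i @[k --> F] --> x i) ->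
  tuple_energy (s_ k) t (x_ k) @[k --> F] --> tuple_energy s t x.
Proof.
move=> xinj s_s x_x; rewrite /tuple_energy.
apply: cvg_big => [|i _]; first exact: add_continuous.
apply: cvg_big => [|j ij]; first exact: add_continuous.
by apply: cvg_pair_energy => //; apply: contra_neq ij => /xinj.
Qed.

End tuple_energy.

(** * Configurations and their enumerations *)

Section configurations.
Context {R : realType} {A : metricType R} {N : nat}.
Implicit Types (x y : 'I_N -> A) (s t : R) (w : {fset A}).

(** [N] points are listed by [N] indices, so there can be no repetition. *)
Lemma enumerates_perm x w : enumerates x w ->
  injective x /\ perm_eq w [seq x i | i <- enum 'I_N].
Proof.
move=> [wN xw].
have eqi : w =i [seq x i | i <- enum 'I_N].
  move=> a; apply/idP/mapP => [aw|[i _ ->]].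
    have : range x a by rewrite xw.
    by case=> i _ <-; exists i => //; rewrite mem_enum.
  have : range x (x i) by exists i.
  by rewrite xw.
have sz : (size [seq x i | i <- enum 'I_N] <= size w)%N.
  by rewrite size_map size_enum_ord; move: wN => /= <-; rewrite leqnn.
have wx : {subset w <= [seq x i | i <- enum 'I_N]} by move=> a; rewrite eqi.
have uniqx := leq_size_uniq (fset_uniq w) wx sz.
by split; [exact/injectiveP|exact: uniq_perm].
Qed.

Lemma enumerates_energy s t x w : enumerates x w ->
  energy s t w = tuple_energy s t x.
Proof.
move=> /enumerates_perm[xinj wx].
rewrite /energy /tuple_energy (perm_big _ wx)/= big_map big_enum/=.
apply: eq_bigr => i _; rewrite (perm_big _ wx)/= big_map big_enum_cond/=.
apply: eq_big => [j|j ij]; first by rewrite (inj_eq xinj).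
exact: pair_energyE.
Qed.

Lemma configs_enumerates w : configs A N w -> exists x, enumerates x w.
Proof.
move=> wN; have wN' : size w = N by [].
exists (fun i => tnth (in_tuple w) (cast_ord (esym wN') i)); split => //.
apply/seteqP; split => a /=.
  by case=> i _ <-; exact: mem_tnth.
move=> /(tnthP (in_tuple w))[i ->]; exists (cast_ord wN' i) => //.
by rewrite cast_ordK.
Qed.

Lemma injective_enumerates x : injective x -> exists w, enumerates x w.
Proof.
move=> xinj; exists [fset x i | i in 'I_N]%fset; split.
  by rewrite /configs/= card_imfset//= size_enum_ord.
apply/seteqP; split => a /=.
  by case=> i _ <-; apply/imfsetP; exists i.
by move=> /imfsetP[i _ ->]; exists i.
Qed.

Lemma min_energy_le s t x : injective x ->
  min_energy A s t N <= tuple_energy s t x.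
Proof.
move=> /injective_enumerates[w xw]; rewrite -(enumerates_energy _ _ xw).
apply: ge_inf; last by exists w => //; case: xw.
exists 0 => _ [v /configs_enumerates[y yv] <-].
by rewrite (enumerates_energy _ _ yv) tuple_energy_ge0.
Qed.

Lemma G_setP s t v : G_set A s t N v <->
  exists x, [/\ injective x, tuple_energy s t x = min_energy A s t N
              & tuple_energy s (t + 1) x = v].
Proof.
split.
  case=> w [wN wmin] <-; have [x xw] := configs_enumerates wN.
  exists x; rewrite -!(enumerates_energy _ _ xw); split => //.
  by case: (enumerates_perm xw).
case=> x [xinj xmin <-]; have [w xw] := injective_enumerates xinj.
exists w; last exact: enumerates_energy.
by split; [case: xw|rewrite (enumerates_energy _ _ xw)].
Qed.

End configurations.

(** * Convergence along ultrafilters *)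

(** If the preimage of some neighborhood of [l] were not in [F], an ultrafilter
finer than [F] would contain its complement. *)
Lemma cvg_ultra (T : Type) (U : topologicalType) (F : set_system T)
    {FF : ProperFilter F} (f : T -> U) (l : U) :
  (forall V : set_system T, UltraFilter V -> F `<=` V ->
     f x @[x --> V] --> l) ->
  f x @[x --> F] --> l.
Proof.
move=> Fl B Bl; apply: contrapT => nFB.
pose V := within (~` (f @^-1` B)) F.
have VF : ProperFilter V.
  apply: Build_ProperFilter_ex => P VP; apply: contrapT => nP; apply: nFB.
  suff : F (f @^-1` B) by [].
  apply: filterS (VP : F _) => z zP; apply: contrapT => nB.
  by apply: nP; exists z; apply: zP.
have [W [WU VW]] := ultraFilterLemma VF.
have FW : F `<=` W.
  by move=> P FP; apply: VW; apply: filterS FP => z Pz _.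
have WB : W (f @^-1` B) by exact: (Fl W WU FW).
have WnB : W (~` (f @^-1` B)) by apply: VW; exact: (@filterE _ F).
have WF : ProperFilter W by exact: ultra_proper.
have : W (f @^-1` B `&` ~` (f @^-1` B)) by exact: filterI.
by rewrite setICr => /filter_not_empty.
Qed.

Lemma compact_ultra_cvg (I : Type) (T : topologicalType) (U : set_system I)
    (f : I -> T) : compact [set: T] -> UltraFilter U ->
  exists x : T, f i @[i --> U] --> x.
Proof.
move=> cT UU; have UF : ProperFilter U by exact: ultra_proper.
have [|x [_ xcl]] := cT (f i @[i --> U]) _; first exact: filterT.
exists x => B xB /=; have [//|UnB] := in_ultra_setVsetC (f @^-1` B) UU.
by have [z [nBz Bz]] := xcl (~` B) B UnB xB.
Qed.

(** * Derivatives and one-sided difference quotients *)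

Section difference_quotient.
Context {R : realType} (g : R -> R) (s0 : R).

Lemma differenceE h :
  h^-1 *: ((g \o shift s0) (h *: 1) - g s0) =
  (g (h + s0) - g s0) / (h + s0 - s0).
Proof. by rewrite /= addrK [_ *: 1]mulr1 [RHS]mulrC. Qed.

Lemma shift_dnbhs (f : R -> R) (l : R) :
  f h @[h --> 0^'] --> l <-> f (r - s0) @[r --> s0^'] --> l.
Proof.
split => fl P Pl.
  have [e e0 He] := fl _ Pl; exists e => //= r rs r0.
  apply: He; last by rewrite subr_eq0.
  by rewrite /= sub0r normrN distrC.
have [e e0 He] := fl _ Pl; exists e => //= h /=; rewrite sub0r normrN => he h0.
rewrite -[h](addrK s0); apply: He => /=.
  by rewrite opprD addrCA subrr addr0 normrN.
by rewrite -subr_eq0 addrK.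
Qed.

Let derivableE (l : R) :
  h^-1 *: ((g \o shift s0) (h *: 1) - g s0) @[h --> 0^'] --> l <->
  (g r - g s0) / (r - s0) @[r --> s0^'] --> l.
Proof.
rewrite shift_dnbhs; under eq_fun do rewrite differenceE subrK.
by [].
Qed.

Lemma derivable_one_sided : derivable g s0 1 ->
  is_right_derivative g s0 ('D_1 g s0) /\ is_left_derivative g s0 ('D_1 g s0).
Proof.
move=> /derivableE dg.
by split; [exact: cvg_dnbhs_at_right dg|exact: cvg_dnbhs_at_left dg].
Qed.

Lemma one_sided_derivable l :
  is_right_derivative g s0 l -> is_left_derivative g s0 l ->
  derivable g s0 1 /\ 'D_1 g s0 = l.
Proof.
move=> gr gl.
have /derivableE dg : (g r - g s0) / (r - s0) @[r --> s0^'] --> l.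
  exact: (@cvg_at_right_left_dnbhs R R^o
    (fun r => (g r - g s0) / (r - s0)) s0 l gr gl).
by split; [apply/cvg_ex; exists l|exact: cvg_lim dg].
Qed.

End difference_quotient.

(** * Extremal elements of a set of reals *)

Lemma inf_min (R : realType) (G : set R) (m : R) :
  G m -> lbound G m -> inf G = m.
Proof.
move=> Gm mG; apply/eqP; rewrite eq_le; apply/andP; split.
  by apply: ge_inf => //; exists m.
by apply: lb_le_inf => //; exists m.
Qed.

Lemma sup_max (R : realType) (G : set R) (m : R) :
  G m -> ubound G m -> sup G = m.
Proof.
move=> Gm mG; apply/eqP; rewrite eq_le; apply/andP; split.
  by apply: ge_sup => //; exists m.
by apply: ub_le_sup => //; exists m.
Qed.

(** * Limits of minimal tuples *)

Section minimizers.
Context {R : realType} {A : metricType R} {N : nat}.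
Context (mdist_lt1 : forall x y : A, mdist x y < 1) (t : R) (t0 : 0 <= t).
Implicit Types (x y : 'I_N -> A) (s : R).

Let g s := min_energy A s t N.

Definition minimal_tuple s x := injective x /\ tuple_energy s t x = g s.

Lemma minimal_configs_enumerates s x w :
  minimal_configs A s t N w -> enumerates x w -> minimal_tuple s x.
Proof.
move=> [_ wmin] xw; split; first by case: (enumerates_perm xw).
by rewrite -(enumerates_energy _ _ xw).
Qed.

(** Each minimal tuple competes at the other parameter; the tangent inequality
turns the two comparisons into bounds on the slope of [g]. *)
Lemma min_energy_sandwich r s x y : minimal_tuple s x -> minimal_tuple r y ->
  (r - s) * tuple_energy s (t + 1) y <= g r - g s <=
  (r - s) * tuple_energy r (t + 1) x.
Proof.
move=> [xinj xs] [yinj yr].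
have Ty := tuple_energy_tangent mdist_lt1 s r y t0.
have Tx := tuple_energy_tangent mdist_lt1 r s x t0.
have gy : g s <= tuple_energy s t y := min_energy_le s t yinj.
have gx : g r <= tuple_energy r t x := min_energy_le r t xinj.
by apply/andP; split; lra.
Qed.

Section limits.
Context (I : Type) (F : set_system I) {FF : ProperFilter F}.
Context (s_ : I -> R) (x_ : I -> 'I_N -> A) (s0 : R) (x : 'I_N -> A).
Context (x_x : forall i, x_ k i @[k --> F] --> x i).

(** Distances bounded below by [exp (- M)] stay so in the limit. *)
Lemma separated_limit_injective (M : R) :
  (\forall k \near F, injective (x_ k) /\
     forall i j, i != j -> logdist (x_ k i) (x_ k j) <= M) ->
  injective x.
Proof.
move=> sep i j xij; apply: contrapT => /eqP ij.
have : expR (- M) <= mdist (x i) (x j).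
  have dcvg : mdist (x_ k i) (x_ k j) @[k --> F] --> mdist (x i) (x j).
    exact: cvg_mdist.
  apply: (cvgr_to_ge dcvg).
  apply: filterS sep => k [kinj /(_ _ _ ij)]; rewrite /logdist lerNl => Mk.
  have d0 : 0 < mdist (x_ k i) (x_ k j).
    by rewrite mdist_gt0; apply: contra_neq ij => /kinj.
  by rewrite -[leRHS]lnK ?posrE// ler_expR.
by rewrite xij mdistxx leNgt expR_gt0.
Qed.

Context (s_s0 : s_ k @[k --> F] --> s0) (xinj : injective x).
Context (x_min : \forall k \near F, minimal_tuple (s_ k) (x_ k)).
Context (s0_min : exists y, minimal_tuple s0 y).

(** The limit of [tuple_energy (s_ k) t (x_ k) <= tuple_energy (s_ k) t y],
where [y] is minimal at [s0]. *)
Lemma limit_minimal : minimal_tuple s0 x.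
Proof.
have [y [yinj ymin]] := s0_min.
split=> //; apply/eqP; rewrite eq_le min_energy_le// andbT -ymin.
have Ex : tuple_energy (s_ k) t (x_ k) @[k --> F] --> tuple_energy s0 t x.
  exact: cvg_tuple_energy.
have Ey : tuple_energy (s_ k) t y @[k --> F] --> tuple_energy s0 t y.
  by apply: cvg_tuple_energy => // i; exact: cvg_cst.
have Eyx : tuple_energy (s_ k) t y - tuple_energy (s_ k) t (x_ k) @[k --> F] -->
    tuple_energy s0 t y - tuple_energy s0 t x by exact: cvgB.
rewrite -subr_ge0; apply: (cvgr_to_ge Eyx); apply: filterS x_min => k [_ ->].
rewrite subr_ge0; exact: min_energy_le.
Qed.

(** The sign of [e] tells from which side [s0] is approached, so that both sides
are treated at once. *)
Context (e : R) (s_side : \forall k \near F, 0 < e * (s_ k - s0)).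

Let quotient_sandwich y : minimal_tuple s0 y -> \forall k \near F,
  e * tuple_energy s0 (t + 1) (x_ k) <=
  e * ((g (s_ k) - g s0) / (s_ k - s0)) <= e * tuple_energy (s_ k) (t + 1) y.
Proof.
move=> ymin; apply: filterS2 x_min s_side => k xmin es.
have s0k : s_ k - s0 != 0 by apply: contraTneq es => ->; rewrite mulr0 ltxx.
have c0 : 0 < e / (s_ k - s0).
  have -> : e / (s_ k - s0) = e * (s_ k - s0) / (s_ k - s0) ^+ 2 by field.
  by rewrite divr_gt0// exprn_even_gt0.
have H z : e * z = e / (s_ k - s0) * ((s_ k - s0) * z) by field.
have Hq : e * ((g (s_ k) - g s0) / (s_ k - s0)) =
    e / (s_ k - s0) * (g (s_ k) - g s0) by field.
rewrite Hq (H (tuple_energy _ _ (x_ k))) (H (tuple_energy _ _ y)) !ler_pM2l//.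
exact: min_energy_sandwich.
Qed.

(** The outer terms of the sandwich, in the limit: [e = 1] makes the limit tuple
a least one for the exponent [t + 1], and [e = - 1] a greatest one. *)
Lemma limit_extremal y : minimal_tuple s0 y ->
  e * tuple_energy s0 (t + 1) x <= e * tuple_energy s0 (t + 1) y.
Proof.
move=> ymin.
have Ex : tuple_energy s0 (t + 1) (x_ k) @[k --> F] -->
    tuple_energy s0 (t + 1) x.
  by apply: cvg_tuple_energy => //; exact: cvg_cst.
have Ey : tuple_energy (s_ k) (t + 1) y @[k --> F] -->
    tuple_energy s0 (t + 1) y.
  by apply: cvg_tuple_energy => //; [case: ymin|move=> i; exact: cvg_cst].
have Eyx : e * (tuple_energy (s_ k) (t + 1) y - tuple_energy s0 (t + 1) (x_ k))
    @[k --> F] -->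
    e * (tuple_energy s0 (t + 1) y - tuple_energy s0 (t + 1) x).
  by apply: cvgM; [exact: cvg_cst|exact: cvgB].
rewrite -subr_ge0 -mulrBr; apply: (cvgr_to_ge Eyx).
apply: filterS (quotient_sandwich ymin) => k /andP[+ +].
by move=> /le_trans/[apply]; rewrite mulrBr subr_ge0.
Qed.

(** The limit tuple is itself minimal at [s0], so it can be used on the right of
the sandwich, whose outer terms then have the same limit. *)
Lemma limit_quotient :
  (g (s_ k) - g s0) / (s_ k - s0) @[k --> F] --> tuple_energy s0 (t + 1) x.
Proof.
have xmin := limit_minimal.
have e0 : e != 0.
  have [k] := filter_ex s_side.
  by apply: contraTneq => ->; rewrite mul0r ltxx.
have Ex : tuple_energy s0 (t + 1) (x_ k) @[k --> F] -->
    tuple_energy s0 (t + 1) x.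
  by apply: cvg_tuple_energy => //; exact: cvg_cst.
have Ey : tuple_energy (s_ k) (t + 1) x @[k --> F] -->
    tuple_energy s0 (t + 1) x.
  by apply: cvg_tuple_energy => //; move=> i; exact: cvg_cst.
have eq_cvg : e * ((g (s_ k) - g s0) / (s_ k - s0)) @[k --> F] -->
    e * tuple_energy s0 (t + 1) x.
  apply: (squeeze_cvgr (quotient_sandwich xmin)).
    by apply: cvgM => //; exact: cvg_cst.
  by apply: cvgM => //; exact: cvg_cst.
rewrite -[X in _ --> X](mulKf e0).
under eq_fun do rewrite -[_ / _](mulKf e0).
by apply: cvgM => //; exact: cvg_cst.
Qed.

End limits.

(** * One-sided derivatives of the minimal energy *)

Context (A_compact : compact [set: A]).
Context (min_ex : forall s, 0 <= s -> exists x, minimal_tuple s x).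

(** Along each ultrafilter finer than [F], minimal tuples converge to some
extremal tuple. This tuple may depend on the ultrafilter, but its energy of
exponent [t + 1] does not, being an extremal value. *)
Lemma one_sided_derivative (F : set_system R) {FF : ProperFilter F}
    (s0 e M : R) : 0 <= s0 -> r @[r --> F] --> s0 ->
  (\forall r \near F, 0 <= r) -> (\forall r \near F, 0 < e * (r - s0)) ->
  (\forall r \near F, forall x, minimal_tuple r x ->
     forall i j, i != j -> logdist (x i) (x j) <= M) ->
  exists x, [/\ minimal_tuple s0 x,
    forall y, minimal_tuple s0 y ->
      e * tuple_energy s0 (t + 1) x <= e * tuple_energy s0 (t + 1) y
    & (g r - g s0) / (r - s0) @[r --> F] --> tuple_energy s0 (t + 1) x].
Proof.
move=> s00 Fs0 F0 Fe Fsep.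
have /choice[X Xmin] : forall r, exists x, 0 <= r -> minimal_tuple r x.
  move=> r; have [/min_ex[x xm]|_] := leP 0 r; first by exists x.
  by have [x _] := min_ex (lexx 0); exists x.
have ultra (V : set_system R) : UltraFilter V -> F `<=` V ->
  exists x, [/\ minimal_tuple s0 x,
    forall y, minimal_tuple s0 y ->
      e * tuple_energy s0 (t + 1) x <= e * tuple_energy s0 (t + 1) y
    & (g r - g s0) / (r - s0) @[r --> V] --> tuple_energy s0 (t + 1) x].
  move=> VU FV; have VF : ProperFilter V by exact: ultra_proper.
  have /choice[x Xx] : forall i, exists a : A, X r i @[r --> V] --> a.
    by move=> i; exact: compact_ultra_cvg.
  have Vs0 : r @[r --> V] --> s0 by move=> B /Fs0; exact: FV.
  have Ve : \forall r \near V, 0 < e * (r - s0) by exact: FV.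
  have Vmin : \forall r \near V, minimal_tuple r (X r).
    by apply: FV; apply: filterS F0 => r /Xmin.
  have xinj : injective x.
    apply: (separated_limit_injective Xx (M := M)).
    have /FV Vsep := Fsep.
    apply: filterS2 Vmin Vsep => r rmin /(_ _ rmin) rsep.
    by split => //; case: rmin.
  exists x; split; first exact: limit_minimal Xx Vs0 xinj Vmin (min_ex s00).
    by move=> y; exact: (limit_extremal Xx Vs0 xinj Vmin Ve).
  exact: (limit_quotient Xx Vs0 xinj Vmin (min_ex s00) Ve).
have e0 : e != 0.
  have [r] := filter_ex Fe.
  by apply: contraTneq => ->; rewrite mul0r ltxx.
have [V0 [V0U FV0]] := ultraFilterLemma FF.
have [x [xmin xle _]] := ultra V0 V0U FV0.
exists x; split => //; apply: cvg_ultra => V VU FV.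
have [y [ymin yle]] := ultra V VU FV.
suff -> : tuple_energy s0 (t + 1) x = tuple_energy s0 (t + 1) y by [].
by apply: (mulfI e0); apply/eqP; rewrite eq_le xle// yle.
Qed.

(** The sandwich bounds the energy of exponent [t + 1] at [s0] of the tuples
minimal at [r] by that, at [r], of a fixed tuple minimal at [s0]. The latter
increases with [r]; its value at [s0 + 1] is a bound near [s0]. *)
Lemma right_separated s0 : 0 <= s0 -> exists M,
  \forall r \near s0^'+, forall x, minimal_tuple r x ->
     forall i j, i != j -> logdist (x i) (x j) <= M.
Proof.
move=> s00; have [y ymin] := min_ex s00.
exists (Num.max 1 (tuple_energy (s0 + 1) (t + 1) y)).
have r1 : \forall r \near s0^'+, r < s0 + 1.
  by apply: nbhs_right_lt; rewrite ltrDl.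
have rs0 : \forall r \near s0^'+, s0 < r by exact: nbhs_right_gt.
apply: filterS2 r1 rs0 => r {}r1 {}rs0 x xmin i j ij.
apply: (logdist_le_pair_energyS mdist_lt1 s00 t0).
apply: (le_trans (pair_energy_le_tuple _ _ _ ij)).
have /andP[/le_trans/[apply]] := min_energy_sandwich ymin xmin.
rewrite ler_pM2l ?subr_gt0// => /le_trans; apply.
by apply: le_tuple_energy => //; [exact: addr_ge0|exact: ltW].
Qed.

(** The energy increases with [s]. Hence, for [s0 / 2 < r < s0], a tuple minimal
at [r] has at [s0 / 2] an energy of exponent [t] no greater than [g r], and
[g r] is at most the energy at [s0] of any fixed tuple. *)
Lemma left_separated s0 : 0 < s0 -> exists M,
  \forall r \near s0^'-, forall x, minimal_tuple r x ->
     forall i j, i != j -> logdist (x i) (x j) <= M.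
Proof.
move=> s00; have [y [yinj ymin]] := min_ex (ltW s00).
exists (Num.max 1 (tuple_energy s0 t y / (s0 / 2))).
have r1 : \forall r \near s0^'-, s0 / 2 < r.
  by apply: nbhs_left_gt; rewrite ltr_pdivrMr// ltr_pMr// ltr1n.
have rs0 : \forall r \near s0^'-, r < s0 by exact: nbhs_left_lt.
apply: filterS2 r1 rs0 => r {}r1 {}rs0 x [xinj xmin] i j ij.
have s2 : 0 < s0 / 2 by rewrite divr_gt0.
apply: (logdist_le_pair_energy s2 t0).
apply: (le_trans (pair_energy_le_tuple _ _ _ ij)).
apply: (le_trans (le_tuple_energy mdist_lt1 x t0 (ltW r1))).
rewrite xmin; apply: (le_trans (min_energy_le r t yinj)).
exact: le_tuple_energy (ltW rs0).
Qed.

Lemma right_derivative s0 : 0 <= s0 -> exists x, [/\ minimal_tuple s0 x,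
    forall y, minimal_tuple s0 y ->
      tuple_energy s0 (t + 1) x <= tuple_energy s0 (t + 1) y
    & is_right_derivative g s0 (tuple_energy s0 (t + 1) x)].
Proof.
move=> s00; have [M sep] := right_separated s00.
have gt_s0 : \forall r \near s0^'+, s0 < r by exact: nbhs_right_gt.
have [|||x [xmin xle xq]] :=
  @one_sided_derivative s0^'+ _ s0 1 M s00 _ _ _ sep.
- exact: cvg_within.
- by apply: filterS gt_s0 => r /ltW; exact: le_trans.
- by apply: filterS gt_s0 => r; rewrite mul1r subr_gt0.
- by exists x; split=> // y /xle; rewrite !mul1r.
Qed.

Lemma left_derivative s0 : 0 < s0 -> exists x, [/\ minimal_tuple s0 x,
    forall y, minimal_tuple s0 y ->
      tuple_energy s0 (t + 1) y <= tuple_energy s0 (t + 1) x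
    & is_left_derivative g s0 (tuple_energy s0 (t + 1) x)].
Proof.
move=> s00; have [M sep] := left_separated s00.
have [|||x [xmin xle xq]] :=
  @one_sided_derivative s0^'- _ s0 (-1) M (ltW s00) _ _ _ sep.
- exact: cvg_within.
- by apply: filterS (nbhs_left_gt s00) => r /ltW.
- by apply: filterS (nbhs_left_lt s0) => r; rewrite mulN1r opprB subr_gt0.
- by exists x; split=> // y /xle; rewrite !mulN1r lerN2.
Qed.

(** * Extremal values and cluster configurations *)

Lemma inf_G_set s0 x : minimal_tuple s0 x ->
  (forall y, minimal_tuple s0 y ->
      tuple_energy s0 (t + 1) x <= tuple_energy s0 (t + 1) y) ->
  inf (G_set A s0 t N) = tuple_energy s0 (t + 1) x.
Proof.
move=> [xinj xmin] xle; apply: inf_min; first by apply/G_setP; exists x.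
by move=> _ /G_setP[y [yinj ymin <-]]; exact: xle.
Qed.

Lemma sup_G_set s0 x : minimal_tuple s0 x ->
  (forall y, minimal_tuple s0 y ->
      tuple_energy s0 (t + 1) y <= tuple_energy s0 (t + 1) x) ->
  sup (G_set A s0 t N) = tuple_energy s0 (t + 1) x.
Proof.
move=> [xinj xmin] xle; apply: sup_max; first by apply/G_setP; exists x.
by move=> _ /G_setP[y [yinj ymin <-]]; exact: xle.
Qed.

Lemma is_right_derivative_inf s0 : 0 <= s0 ->
  is_right_derivative g s0 (inf (G_set A s0 t N)).
Proof. by move=> /right_derivative[x [xmin /(inf_G_set xmin) ->]]. Qed.

Lemma is_left_derivative_sup s0 : 0 < s0 ->
  is_left_derivative g s0 (sup (G_set A s0 t N)).
Proof. by move=> /left_derivative[x [xmin /(sup_G_set xmin) ->]]. Qed.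

Context (omega : R -> {fset A}).
Context (omega_min : forall s, 0 <= s -> minimal_configs A s t N (omega s)).

(** The points of [w] are distinct by definition of a cluster configuration, so
the limit lemmas apply to the enumerations without any bound on distances. *)
Lemma cluster_config_extremal (D : set R) (s0 e : R) w : 0 <= s0 ->
  (forall s, D s -> 0 <= s /\ 0 < e * (s - s0)) ->
  cluster_config N omega D s0 w ->
  exists x, [/\ enumerates x w, minimal_tuple s0 x
    & forall y, minimal_tuple s0 y ->
      e * tuple_energy s0 (t + 1) x <= e * tuple_energy s0 (t + 1) y].
Proof.
move=> s00 De [_ [s_ [Ds s_s0 [x_ [x [x_omega xw]]]]]].
move=> x_ptws; exists x.
have x_x i : x_ k i @[k --> \oo] --> x i.
  exact: cvg_comp x_ptws (@proj_continuous _ (fun _ : 'I_N => A) i x).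
have [xinj _] := enumerates_perm xw.
have x_min : \forall k \near \oo, minimal_tuple (s_ k) (x_ k).
  apply: filterE => k; have [sk0 _] := De _ (Ds k).
  exact: minimal_configs_enumerates (omega_min sk0) (x_omega k).
have s_side : \forall k \near \oo, 0 < e * (s_ k - s0).
  by apply: filterE => k; have [] := De _ (Ds k).
split=> //; first exact: limit_minimal x_x s_s0 xinj x_min (min_ex s00).
by move=> y; exact: (limit_extremal x_x s_s0 xinj x_min s_side).
Qed.

Lemma right_cluster_energy s0 w : 0 <= s0 ->
  right_cluster_config N omega s0 w ->
  energy s0 (t + 1) w = inf (G_set A s0 t N).
Proof.
move=> s00 /(@cluster_config_extremal _ _ 1 _ s00)[].
  move=> s /=; rewrite in_itv/= andbT mul1r subr_gt0 => s0s; split=> //.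
  exact: le_trans (ltW s0s).
move=> x [xw xmin xle]; rewrite (enumerates_energy _ _ xw) (inf_G_set xmin)//.
by move=> y /xle; rewrite !mul1r.
Qed.

Lemma left_cluster_energy s0 w : 0 < s0 ->
  left_cluster_config N omega s0 w ->
  energy s0 (t + 1) w = sup (G_set A s0 t N).
Proof.
move=> s00 /(@cluster_config_extremal _ _ (-1) _ (ltW s00))[].
  by move=> s /=; rewrite in_itv/= mulN1r opprB subr_gt0 => /andP[].
move=> x [xw xmin xle]; rewrite (enumerates_energy _ _ xw) (sup_G_set xmin)//.
by move=> y /xle; rewrite !mulN1r lerN2.
Qed.

End minimizers.

Lemma mdist_le_diam (R : realType) (A : metricType R) (B : set A) (x y : A) :
  B x -> B y -> ((mdist x y)%:E <= diam B)%E.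
Proof. by move=> Bx By; apply: ereal_sup_ubound; exists (x, y). Qed.

Theorem theorem2p5 (R : realType) (N : nat) (hN : (2 <= N)%N)
    (t : R) (ht : 0 <= t)
    (A : metricType R) (A_infinite : infinite_set [set: A])
    (A_compact : compact [set: A]) (A_diam : (diam [set: A] < 1)%E)
    (omega : R -> {fset A})
    (omega_min : forall s : R, 0 <= s -> minimal_configs A s t N (omega s)) :
  let g := fun s : R => min_energy A s t N in
  [/\ forall s0 : R, 0 < s0 ->
        (derivable g s0 1 <-> inf (G_set A s0 t N) = sup (G_set A s0 t N)),
      forall (s0 : R) (w : {fset A}), 0 <= s0 ->
        right_cluster_config N omega s0 w ->
        energy s0 (t + 1) w = inf (G_set A s0 t N) /\
        is_right_derivative g s0 (inf (G_set A s0 t N)),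
      forall (s0 : R) (w : {fset A}), 0 < s0 ->
        left_cluster_config N omega s0 w ->
        energy s0 (t + 1) w = sup (G_set A s0 t N) /\
        is_left_derivative g s0 (sup (G_set A s0 t N))
    & forall (s0 : R), 0 < s0 ->
        forall w : {fset A},
        right_cluster_config N omega s0 w ->
        left_cluster_config N omega s0 w ->
        derivable g s0 1 /\ energy s0 (t + 1) w = 'D_1 g s0].
Proof.
have lt1 (x y : A) : mdist x y < 1.
  rewrite -lte_fin; exact: le_lt_trans (mdist_le_diam I I) A_diam.
have min_ex (s : R) : 0 <= s -> exists x : 'I_N -> A, minimal_tuple t s x.
  move=> s_ge0; have smin := omega_min s s_ge0.
  have [x xw] := configs_enumerates smin.1.
  by exists x; exact: minimal_configs_enumerates xw.
have right (s0 : R) (s00 : 0 <= s0) :=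
  is_right_derivative_inf lt1 ht A_compact min_ex s00.
have left (s0 : R) (s00 : 0 < s0) :=
  is_left_derivative_sup lt1 ht A_compact min_ex s00.
have rightE (s0 : R) w (s00 : 0 <= s0) :=
  right_cluster_energy lt1 ht min_ex omega_min s00 (w := w).
have leftE (s0 : R) w (s00 : 0 < s0) :=
  left_cluster_energy lt1 ht min_ex omega_min s00 (w := w).
move=> g; split.
- move=> s0 s00; have rd := right _ (ltW s00); have ld := left _ s00.
  split=> [/derivable_one_sided[rd' ld']|eG].
    by rewrite (cvg_unique _ rd rd')// (cvg_unique _ ld ld').
  by rewrite -eG in ld; have [] := one_sided_derivable rd ld.
- by move=> s0 w s00 /(rightE _ _ s00) ->; split=> //; exact: right.
- by move=> s0 w s00 /(leftE _ _ s00) ->; split=> //; exact: left.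
- move=> s0 s00 w /(rightE _ _ (ltW s00)) wr /(leftE _ _ s00) wl.
  have rd := right _ (ltW s00); have ld := left _ s00.
  rewrite -wl in ld; rewrite -wr in rd.
  by have [dg ->] := one_sided_derivable rd ld.
Qed.
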